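(* Let $a,b$ be positive integers with $\gcd(a,b)=1$ and $\min(a,b)\ge 2$. Let $Q$ be the quiver (with no frozen vertices) on mutable vertices $1,2,3$ having exactly $a$ arrows $3\to 1$, exactly $b$ arrows $2\to 1$, and no other arrows, and let $\Sigma$ be a seed with quiver $Q$. Then the cluster variety $\mathcal A(\Sigma)$ has mysterious points.
   Context: Let $n\ge 1$, $m\ge 0$. An ice quiver $Q$ has mutable vertices $1,\dots,n$ and frozen vertices $n+1,\dots,n+m$, no loops, no oriented $2$-cycles, and no arrows between frozen vertices; $\tilde B(Q)=(b_{ij})$ with $b_{ij}=\#\{i\to j\}-\#\{j\to i\}$. Mutation $\mu_k(Q)$: for each path $i\to k\to j$ ($i,j$ not both frozen) add $i\to j$, reverse arrows at $k$, cancel oriented $2$-cycles. A seed $\Sigma=(\tilde B(Q),\tilde{\mathbf x})$ has $\tilde{\mathbf x}=(x_1,\dots,x_{n+m})$ free generators of $\mathbb C(x_1,\dots,x_{n+m})$; $\mu_k(\Sigma)$ replaces $x_k$ by $x_k'=x_k^{-1}\big(\prod_{b_{ik}>0}x_i^{b_{ik}}+\prod_{b_{ik}<0}x_i^{-b_{ik}}\big)$ and $Q$ by $\mu_k(Q)$. $\mathsf{Seeds}(\Sigma)$: all iterated mutations. The cluster algebra $A(\Sigma)$ is the $\mathbb C[x_{n+1}^{\pm1},\dots,x_{n+m}^{\pm1}]$-subalgebra of the field generated by all cluster variables of all seeds in $\mathsf{Seeds}(\Sigma)$; $\mathcal A(\Sigma)=\mathrm{Spec}\,A(\Sigma)$.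 For $\Sigma'=(\tilde B',(z_i))\in\mathsf{Seeds}(\Sigma)$, the cluster torus $T(\Sigma')$ is the locus where all $z_i\ne 0$. A point is deep if it lies in no cluster torus. The cluster dilation group $\mathrm{Dil}(\Sigma)$ consists of algebra automorphisms of $A(\Sigma)$ rescaling every cluster variable of every seed by a nonzero constant; a point is mysterious if it is deep and has trivial stabilizer in $\mathrm{Dil}(\Sigma)$. *)

(* Defs.v *)
From HB Require Import structures.
From mathcomp Require Import all_boot all_order all_algebra.
From mathcomp Require Import fraction complex boolp reals.
From mathcomp Require Import mpoly.

Set Implicit Arguments.
Unset Strict Implicit.
Unset Printing Implicit Defensive.

Import Order.TTheory GRing.Theory Num.Theory.
Local Open Scope ring_scope.

(** Ice quivers with [n] mutable and [m] frozen vertices, given by their arrow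
    counts: [q i j] is the number of arrows [i -> j].  Vertices are numbered
    from 0, so that the mutable ones are the [lshift m k] with [k : 'I_n] and
    the frozen ones the [rshift n j] with [j : 'I_m]. *)

Section Quiver.
Variables n m : nat.
Implicit Types (q : 'M[nat]_(n + m)) (k : 'I_n).

Definition frozen (i : 'I_(n + m)) : bool := (n <= i)%N.

Definition is_ice_quiver q : Prop :=
  [/\ forall i, q i i = 0%N,
      forall i j, q i j = 0%N \/ q j i = 0%N
    & forall i j, frozen i -> frozen j -> q i j = 0%N].

(* The extended exchange matrix: its columns are the mutable vertices. *)
Definition exchange_matrix q : 'M[int]_(n + m, n) :=
  \matrix_(i, j) ((q i (lshift m j))%:Z - (q (lshift m j) i)%:Z).

Definition add_paths k q : 'M[nat]_(n + m) :=
  let v := lshift m k in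
  \matrix_(i, j) (if frozen i && frozen j then q i j
                  else q i j + q i v * q v j)%N.

Definition reverse_at k q : 'M[nat]_(n + m) :=
  let v := lshift m k in
  \matrix_(i, j) (if (i == v) || (j == v) then q j i else q i j).

(* The subtraction of natural numbers is truncated. *)
Definition cancel_2cycles q : 'M[nat]_(n + m) :=
  \matrix_(i, j) (q i j - q j i)%N.

Definition mutate_quiver k q : 'M[nat]_(n + m) :=
  cancel_2cycles (reverse_at k (add_paths k q)).

End Quiver.

(** The field [C(x_1, ..., x_N)], as a [C]-algebra. *)

Section RationalFunctions.
Variables (C : closedFieldType) (N : nat).

Definition ratfun : Type := {fraction {mpoly C[N]}}.

HB.instance Definition _ := GRing.Field.on ratfun.

Definition ratfunC (c : C) : ratfun := tofrac (mpolyC N c).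

Definition ratfun_scale (c : C) (f : ratfun) : ratfun := ratfunC c * f.

Fact ratfun_scaleA a b f :
  ratfun_scale a (ratfun_scale b f) = ratfun_scale (a * b) f.
Proof. by rewrite /ratfun_scale /ratfunC !rmorphM /= mulrA. Qed.

Fact ratfun_scale1 : left_id 1 ratfun_scale.
Proof. by move=> f; rewrite /ratfun_scale /ratfunC !rmorph1 mul1r. Qed.

Fact ratfun_scaleDr : right_distributive ratfun_scale +%R.
Proof. by move=> a f g; rewrite /ratfun_scale mulrDr. Qed.

Fact ratfun_scaleDl f : {morph ratfun_scale^~ f : a b / a + b}.
Proof. by move=> a b; rewrite /ratfun_scale /ratfunC !rmorphD /= mulrDl. Qed.

HB.instance Definition _ := GRing.Zmodule_isLmodule.Build C ratfun
  ratfun_scaleA ratfun_scale1 ratfun_scaleDr ratfun_scaleDl.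

Fact ratfun_scaleAl (c : C) (f g : ratfun) : c *: (f * g) = c *: f * g.
Proof. exact: mulrA. Qed.

HB.instance Definition _ :=
  GRing.Lmodule_isLalgebra.Build C ratfun ratfun_scaleAl.
HB.instance Definition _ := GRing.Lalgebra_isComAlgebra.Build C ratfun.

(* [p(z_1, ..., z_N)] *)
Definition eval_at (z : {ffun 'I_N -> ratfun}) (p : {mpoly C[N]}) : ratfun :=
  mmap (in_alg ratfun) z p.

Definition free_generators (z : {ffun 'I_N -> ratfun}) : Prop :=
  (forall p, eval_at z p = 0 -> p = 0) /\
  (forall f, exists p q, q != 0 /\ f = eval_at z p / eval_at z q).

End RationalFunctions.

Section Seeds.
Variables (C : closedFieldType) (n m : nat).

(* For an ice quiver, [quiver] and its extended exchange matrix determine each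
   other, as there are no arrows between frozen vertices. *)
Record seed := Seed {
  quiver : 'M[nat]_(n + m);
  cluster : {ffun 'I_(n + m) -> ratfun C (n + m)}
}.

Definition is_seed (S : seed) : Prop :=
  is_ice_quiver (quiver S) /\ free_generators (cluster S).

Definition mutate (k : 'I_n) (S : seed) : seed :=
  let b := exchange_matrix (quiver S) in
  let x := cluster S in
  Seed (mutate_quiver k (quiver S))
    [ffun i => if i == lshift m k then
        (x i)^-1 * (\prod_(j | 0 < b j k) x j ^+ `|b j k|%N
                    + \prod_(j | b j k < 0) x j ^+ `|b j k|%N)
      else x i].

Inductive Seeds (S : seed) : seed -> Prop :=
| Seeds_refl : Seeds S S
| Seeds_mutate (S' : seed) (k : 'I_n) : Seeds S S' -> Seeds S (mutate k S').

End Seeds.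

(** The cluster algebra, its spectrum and its dilation group. *)

Section ClusterAlgebra.
Variables (C : closedFieldType) (n m : nat) (S : seed C n m).

(* The frozen variables are common to all the seeds. *)
Inductive in_cluster_algebra : ratfun C (n + m) -> Prop :=
| in_cluster S' (k : 'I_n) :
    Seeds S S' -> in_cluster_algebra (cluster S' (lshift m k))
| in_frozen (j : 'I_m) : in_cluster_algebra (cluster S (rshift n j))
| in_frozenV (j : 'I_m) : in_cluster_algebra (cluster S (rshift n j))^-1
| in_scalar (c : C) : in_cluster_algebra c%:A
| in_add f g :
    in_cluster_algebra f -> in_cluster_algebra g -> in_cluster_algebra (f + g)
| in_mul f g :
    in_cluster_algebra f -> in_cluster_algebra g -> in_cluster_algebra (f * g).

Definition cluster_algebra_pred : {pred ratfun C (n + m)} :=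
  fun f => `[< in_cluster_algebra f >].

Fact cluster_algebra_closed : subalg_closed cluster_algebra_pred.
Proof.
split=> [|c f g /asboolP hf /asboolP hg|f g /asboolP hf /asboolP hg];
  apply/asboolP.
- by rewrite -(scale1r 1); exact: in_scalar.
- apply: in_add hg; rewrite -(mul1r f) scalerAl.
  by apply: in_mul hf; exact: in_scalar.
- exact: in_mul.
Qed.

HB.instance Definition _ :=
  GRing.isSubalgClosed.Build C (ratfun C (n + m)) cluster_algebra_pred
    cluster_algebra_closed.

Record cluster_algebra := ClusterAlgebra {
  cluster_algebra_val :> ratfun C (n + m);
  _ : cluster_algebra_val \in cluster_algebra_pred
}.

HB.instance Definition _ := [isSub for cluster_algebra_val].
HB.instance Definition _ := [Choice of cluster_algebra by <:].
HB.instance Definition _ := [SubChoice_isSubComNzRing of cluster_algebra by <:].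
HB.instance Definition _ := [SubZmodule_isSubLmodule of cluster_algebra by <:].
HB.instance Definition _ :=
  [SubNzRing_SubLmodule_isSubLalgebra of cluster_algebra by <:].
HB.instance Definition _ := [SubLalgebra_isSubAlgebra of cluster_algebra by <:].

Lemma cluster_frozen S' (j : 'I_m) :
  Seeds S S' -> cluster S' (rshift n j) = cluster S (rshift n j).
Proof. by elim=> //= {}S' k _ IH; rewrite ffunE eq_rlshift. Qed.

Fact cluster_in S' (i : 'I_(n + m)) :
  Seeds S S' -> cluster S' i \in cluster_algebra_pred.
Proof.
move=> hS; apply/asboolP; case: (split_ordP i) => [k ->|j ->].
  exact: in_cluster.
by rewrite cluster_frozen //; exact: in_frozen.
Qed.

Definition cluster_elt S' (hS : Seeds S S') (i : 'I_(n + m)) :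
    cluster_algebra :=
  ClusterAlgebra (cluster_in i hS).

(* The [C]-points of the affine variety [Spec A(S)]. *)
Definition cluster_variety : Type := {lrmorphism cluster_algebra -> C | *%R}.

Definition in_cluster_torus (p : cluster_variety) S' (hS : Seeds S S') : Prop :=
  forall i, p (cluster_elt hS i) != 0.

Definition deep (p : cluster_variety) : Prop :=
  forall S' (hS : Seeds S S'), ~ in_cluster_torus p hS.

(* Frozen variables are rescaled too, as is usual for cluster dilations. *)
Definition dilation (phi : {lrmorphism cluster_algebra -> cluster_algebra}) :
    Prop :=
  bijective phi /\
  forall S' (hS : Seeds S S') i,
    exists2 c : C, c != 0 & phi (cluster_elt hS i) = c *: cluster_elt hS i.

(* An automorphism [phi] of the algebra moves the point [p] to [p \o phi]. *)
Definition trivial_stabilizer (p : cluster_variety) : Prop :=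
  forall phi : {lrmorphism cluster_algebra -> cluster_algebra},
    dilation phi -> p \o phi =1 p -> phi =1 id.

Definition mysterious (p : cluster_variety) : Prop :=
  deep p /\ trivial_stabilizer p.

End ClusterAlgebra.

(* Vertices 1, 2, 3 are 0, 1, 2 here: [a] arrows 3 -> 1 and [b] arrows 2 -> 1. *)
Definition quiver_ab (a b : nat) : 'M[nat]_(3 + 0) :=
  \matrix_(i, j) (if (i == 2 :> nat) && (j == 0 :> nat) then a
                  else if (i == 1 :> nat) && (j == 0 :> nat) then b
                  else 0)%N.

(* Main.v *)
(** Write [x1, x2, x3] for the initial cluster, so that mutation at vertex 1
    gives [x1' = (x2 ^ b * x3 ^ a + 1) / x1].  The point where [x1 = x1' = 0]
    and [x2 ^ b * x3 ^ a = -1] is mysterious.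

    It is deep because in every seed [(z1, z2, z3)], [z1] and its mutation [z1']
    vanish at the point while [z2] and [z3] do not.  Mutating [z2] replaces
    [z1'] by a unit times [z1'] plus a multiple of [z1 ^ (e - 1)], where [e] is
    the number of arrows between vertices 1 and 2 (and similarly for [z3]).  The
    number of arrows between 1 and 2 remains [b] times an integer prime to [a],
    and that between 1 and 3 remains [a] times an integer prime to [b], so that
    [e >= 2] throughout.

    A dilation that fixes the point fixes [x2] and [x3], which are nonzero
    there; the relations [x2 * x2' = 1 + x1 ^ b] and [x3 * x3' = 1 + x1 ^ a]
    then force it to scale [x1] by a constant whose [a]-th and [b]-th powers
    are 1, i.e. by 1.

    No presentation of the cluster algebra is needed: the point is the
    restriction of a place of the function field. *)

From HB Require Import structures.
Require Import Defs.
From mathcomp Require Import all_boot all_order all_algebra.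
From mathcomp Require Import complex reals boolp fraction mpoly.
From mathcomp Require Import zify ring.

Set Implicit Arguments.
Unset Strict Implicit.
Unset Printing Implicit Defensive.

Import Order.TTheory GRing.Theory Num.Theory.
Local Open Scope ring_scope.

(** * Places of a field, as graphs of partial maps *)

Section Places.
Variables F K : fieldType.

(* [P] is the graph of a ring morphism from a local subring of [F] to [K] that
   sends non-units to 0. *)
Definition place (P : F -> K -> Prop) : Prop :=
  [/\ forall f c d, P f c -> P f d -> c = d,
      P 1 1,
      forall f g c d, P f c -> P g d -> P (f - g) (c - d),
      forall f g c d, P f c -> P g d -> P (f * g) (c * d)
    & forall f c, P f c -> c != 0 -> P f^-1 c^-1].

Variables (P : F -> K -> Prop) (hP : place P).

Lemma place_inj f c d : P f c -> P f d -> c = d.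
Proof. by case: hP => h _ _ _ _; exact: h. Qed.

Lemma place1 : P 1 1. Proof. by case: hP. Qed.

Lemma placeB f g c d : P f c -> P g d -> P (f - g) (c - d).
Proof. by case: hP => _ _ h _ _; exact: h. Qed.

Lemma placeM f g c d : P f c -> P g d -> P (f * g) (c * d).
Proof. by case: hP => _ _ _ h _; exact: h. Qed.

Lemma placeV f c : P f c -> c != 0 -> P f^-1 c^-1.
Proof. by case: hP => _ _ _ _ h; exact: h. Qed.

Lemma place0 : P 0 0.
Proof. by have := placeB place1 place1; rewrite !subrr. Qed.

Lemma placeN f c : P f c -> P (- f) (- c).
Proof. by move=> /(placeB place0); rewrite !sub0r. Qed.

Lemma placeD f g c d : P f c -> P g d -> P (f + g) (c + d).
Proof. by move=> hf /placeN /(placeB hf); rewrite !opprK. Qed.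

Lemma placeX f c k : P f c -> P (f ^+ k) (c ^+ k).
Proof.
move=> hf; elim: k => [|k IH]; rewrite ?expr0 ?exprS; first exact: place1.
exact: placeM.
Qed.

Lemma place_neq0 f c : P f c -> c != 0 -> f != 0.
Proof.
move=> hf; apply: contraNneq => f0; rewrite f0 in hf.
by rewrite (place_inj hf place0).
Qed.

Lemma place_divl f g c d : P (g * f) c -> P g d -> d != 0 -> P f (c / d).
Proof.
move=> hgf hg d0; rewrite -(mulKf (place_neq0 hg d0) f) mulrC.
exact: placeM hgf (placeV hg d0).
Qed.

(* If [zk] is mutated first, the variable [w] that a subsequent mutation of
   [z1] produces is, up to units, the old [z'] modulo [z1 ^+ p.-1]. *)
Lemma place_exchange (z1 z' zk zl zk' w : F) (ck cl : K)
    (p r r' s s' t t' : nat) :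
  z1 != 0 -> (1 < p)%N -> P z1 0 -> P z' 0 ->
  P zk ck -> ck != 0 -> P zl cl -> cl != 0 ->
  z1 * z' = zk ^+ p * zl ^+ r + zl ^+ r' ->
  zk * zk' = zl ^+ s' + z1 ^+ p * zl ^+ s ->
  z1 * w = zl ^+ t + zk' ^+ p * zl ^+ t' ->
  (t + r' = r + s' * p + t')%N ->
  P w 0.
Proof.
move=> z1_neq0 p_gt1 hz1 hz' hk ck0 hl cl0 e1 ek ew et.
pose v := zl ^+ s' + z1 ^+ p * zl ^+ s.
(* [D] is the cofactor of [v - zl ^+ s'] in [v ^+ p - zl ^+ (s' * p)]; the factor [v - zl ^+ s'] is
   itself a multiple of [z1 ^+ p]. *)
pose D := \sum_(i < p) v ^+ (p.-1 - i) * (zl ^+ s') ^+ i.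
have z1p e : (0 < e)%N -> P (z1 ^+ e) 0.
  by move=> e0; have := placeX e hz1; rewrite expr0n eqn0Ngt e0.
have [d hD] : exists d, P D d.
  rewrite /D; elim: (index_enum _) => [|i q [d IH]].
    by exists 0; rewrite big_nil; exact: place0.
  have hv : P v (cl ^+ s' + 0 * cl ^+ s).
    apply: placeD (placeX _ hl) (placeM _ (placeX _ hl)).
    by apply: z1p; exact: ltnW.
  rewrite big_cons; eexists; apply: placeD IH.
  by apply: placeM; [exact: placeX hv|exact: placeX (placeX _ hl)].
have ev : v ^+ p = zl ^+ (s' * p) + z1 ^+ p * zl ^+ s * D.
  have := subrXX v (zl ^+ s') p.
  rewrite {2}/v [_ + _ - _]addrAC subrr add0r -exprM => /eqP.
  by rewrite subr_eq addrC => /eqP ->; congr (_ + _ * _).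
(* After multiplication by [z1], the hypothesis on exponents makes the terms free of [D] combine to
   [zl ^+ t * (z1 * z')]. *)
have key : (zk ^+ p * zl ^+ r) * w
         = zl ^+ t * z' + z1 ^+ p.-1 * (zl ^+ s * D * zl ^+ t' * zl ^+ r).
  apply: (mulfI z1_neq0).
  rewrite mulrCA ew mulrDr.
  have -> : zk ^+ p * zl ^+ r * (zk' ^+ p * zl ^+ t')
     = (zk * zk') ^+ p * zl ^+ (r + t') by rewrite exprMn exprD; ring.
  rewrite ek -/v ev mulrDl -exprD.
  have -> : (s' * p + (r + t') = t + r')%N by rewrite et; ring.
  have ep : z1 * z1 ^+ p.-1 = z1 ^+ p by rewrite -exprS prednK // ltnW.
  rewrite mulrDr (mulrA z1 (z1 ^+ p.-1)) ep (mulrCA z1) e1 !exprD; ring.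
have h0 : P (zk ^+ p * zl ^+ r * w) 0.
  rewrite key.
  have <- : cl ^+ t * 0 + 0 * (cl ^+ s * d * cl ^+ t' * cl ^+ r) = 0.
    by rewrite mulr0 mul0r addr0.
  apply: placeD; first exact: placeM (placeX _ hl) hz'.
  (* As [p] is at least 2, the exponent [p.-1] is positive and the error term vanishes. *)
  apply: placeM; first by apply: z1p; rewrite -ltnS prednK // ltnW.
  by do !apply: placeM => //; exact: placeX.
have hu := placeM (placeX p hk) (placeX r hl).
have u0 : ck ^+ p * cl ^+ r != 0 by rewrite mulf_neq0 ?expf_neq0.
by rewrite -(mul0r (ck ^+ p * cl ^+ r)^-1); exact: place_divl h0 hu u0.
Qed.

End Places.

(** A nonzero final value forces a nonzero intermediate one, which gives the axiom on inverses.
    Composites assign values to fractions that read 0/0 at a point but are defined along a curve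
    through it. *)
Lemma place_comp (F K L : fieldType) (P : F -> K -> Prop) (Q : K -> L -> Prop) :
  place P -> place Q -> place (fun f c => exists2 g, P f g & Q g c).
Proof.
move=> hP hQ.
split=> [f c d [g hg hc] [g' hg' hd]||f g c d [f' hf hc] [g' hg hd]
  |f g c d [f' hf hc] [g' hg hd]|f c [g hg hc] c0].
- rewrite (place_inj hP hg' hg) in hd. exact: (place_inj hQ hc hd).
- by exists 1; exact: place1.
- by exists (f' - g'); [exact: (placeB hP)|exact: (placeB hQ)].
- by exists (f' * g'); [exact: (placeM hP)|exact: (placeM hQ)].
- exists g^-1; last exact: (placeV hQ).
  by apply: (placeV hP) => //; exact: (place_neq0 hQ hc).
Qed.

(** * Places obtained by localizing a ring morphism *)

Section Specialization.
Variables (A : comNzRingType) (F K : fieldType).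
Variables (iota : {rmorphism A -> F}) (phi : {rmorphism A -> K}).

(** For injective [iota], the graph of the extension of [phi] to the localization of [A] at the
    kernel of [phi], with denominators cleared. *)
Definition specializes (f : F) (c : K) : Prop :=
  exists P Q, [/\ phi Q != 0, f * iota Q = iota P & c * phi Q = phi P].

Lemma specializes_intro P : specializes (iota P) (phi P).
Proof. by exists P, 1; rewrite !rmorph1 !mulr1 oner_neq0. Qed.

Hypothesis iota_inj : forall P, iota P = 0 -> P = 0.

Lemma place_specializes : place specializes.
Proof.
have nz Q : phi Q != 0 -> iota Q != 0.
  by apply: contra_neq => /iota_inj ->; rewrite rmorph0.
split.
- move=> f c d [P [Q [Q0 ef ec]]] [P' [Q' [Q0' ef' ed]]].
  have e0 : P * Q' - P' * Q = 0.
    by apply: iota_inj; rewrite rmorphB !rmorphM -ef -ef'; ring.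
  apply: (mulIf (mulf_neq0 Q0 Q0')); apply/eqP; rewrite -subr_eq0; apply/eqP.
  have := congr1 phi e0; rewrite rmorph0 rmorphB !rmorphM -ec -ed => <-; ring.
- by have := specializes_intro 1; rewrite !rmorph1.
- move=> f g c d [P [Q [Q0 ef ec]]] [P' [Q' [Q0' eg ed]]].
  exists (P * Q' - P' * Q), (Q * Q').
  rewrite !rmorphB !rmorphM -ef -ec -eg -ed mulf_neq0 //.
  by split=> //; ring.
- move=> f g c d [P [Q [Q0 ef ec]]] [P' [Q' [Q0' eg ed]]].
  exists (P * P'), (Q * Q').
  rewrite !rmorphM -ef -ec -eg -ed mulf_neq0 //.
  by split=> //; ring.
- move=> f c [P [Q [Q0 ef ec]]] c0.
  have P0 : phi P != 0 by rewrite -ec mulf_neq0.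
  exists Q, P; split=> //; last by rewrite -ec mulKf.
  rewrite -ef mulKf //.
  by apply: contraNneq (nz _ P0) => f0; rewrite -ef f0 mul0r.
Qed.

End Specialization.

(** * Signed arrow counts and their mutation *)

Section Quivers.
Variables n m : nat.
Implicit Types (q : 'M[nat]_(n + m)) (i j : 'I_(n + m)).

(** The case [i = j] excludes loops as well. *)
Definition no_2cycles q : Prop := forall i j, q i j = 0%N \/ q j i = 0%N.

Definition net q i j : int := (q i j)%:Z - (q j i)%:Z.

Lemma frozen_lshift (k : 'I_n) : frozen (lshift m k) = false.
Proof. by rewrite /frozen /= leqNgt ltn_ord. Qed.

Lemma no_2cycles_mutate (k : 'I_n) q : no_2cycles (mutate_quiver k q).
Proof. by move=> i j; rewrite !mxE; lia. Qed.

(** Net counts are blind to the cancellation of 2-cycles. *)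
Lemma net_mutate (k : 'I_n) q i j (v := lshift m k) :
  no_2cycles q -> ~~ (frozen i && frozen j) ->
  net (mutate_quiver k q) i j =
    if (i == v) || (j == v) then - net q i j
    else net q i j + ((q i v * q v j)%N%:Z - (q j v * q v i)%N%:Z).
Proof.
move=> hq fr; rewrite /net !mxE (andbC (frozen j)) (negbTE fr) -/v.
have qv : q v v = 0%N by case: (hq v v).
rewrite (orbC (j == v)); case: ifPn => [/orP[] /eqP -> |_]; rewrite ?qv; lia.
Qed.

(** Paths between [i] and [j] through [v] run in at most one direction, so [s] is 0, 1 or -1. Hence
    mutation at [v] changes a net count by a multiple of the product of two others. *)
Lemma net_paths q i j v : no_2cycles q -> exists s : int,
  (q i v * q v j)%N%:Z - (q j v * q v i)%N%:Z = s * (net q i v * net q v j).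
Proof.
move=> hq; rewrite /net.
have [e|e] := hq i v; have [e'|e'] := hq j v; rewrite e e'.
- by exists 0; lia.
- by exists (-1); lia.
- by exists 1; lia.
- by exists 0; lia.
Qed.

Lemma prod_in_arrows (F : fieldType) (x : 'I_(n + m) -> F) q (k : 'I_n) :
  no_2cycles q ->
  \prod_(j | 0 < exchange_matrix q j k) x j ^+ `|exchange_matrix q j k|%N
    = \prod_j x j ^+ q j (lshift m k).
Proof.
move=> hq; rewrite big_mkcond; apply: eq_bigr => j _; rewrite mxE.
have [e|e] := hq j (lshift m k); rewrite e; last first.
  rewrite subr0; case: ifPn => // h.
  by have -> : q j (lshift m k) = 0%N by lia.
case: ifPn => //; lia.
Qed.

Lemma prod_out_arrows (F : fieldType) (x : 'I_(n + m) -> F) q (k : 'I_n) :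
  no_2cycles q ->
  \prod_(j | exchange_matrix q j k < 0) x j ^+ `|exchange_matrix q j k|%N
    = \prod_j x j ^+ q (lshift m k) j.
Proof.
move=> hq; rewrite big_mkcond; apply: eq_bigr => j _; rewrite mxE.
have [e|e] := hq j (lshift m k); rewrite e.
  rewrite sub0r; case: ifPn => h; first by rewrite abszN.
  by have -> : q (lshift m k) j = 0%N by lia.
by rewrite subr0 ltNge le0z_nat.
Qed.

End Quivers.

(** * Quivers on three vertices and the invariant class *)

Section ThreeVertices.

Notation v := (lshift 0).
Implicit Types (q : 'M[nat]_(3 + 0)) (o k l : 'I_3).

Lemma prod_three (F : fieldType) (f : 'I_(3 + 0) -> F) o k l :
  uniq [:: o; k; l] -> \prod_j f j = f (v o) * f (v k) * f (v l).
Proof.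
move=> u3; transitivity (\prod_(j <- map v [:: o; k; l]) f j).
  apply: perm_big.
  have u : uniq (map v [:: o; k; l]).
    by rewrite map_inj_uniq //; exact: lshift_inj.
  apply: uniq_perm; rewrite ?index_enum_uniq // => i.
  have [||_ ->] := uniq_min_size (s2 := enum 'I_(3 + 0)) u.
  - by move=> j _; rewrite mem_enum.
  - by rewrite size_enum_ord.
  - by rewrite mem_index_enum mem_enum.
by rewrite big_map !big_cons big_nil mulr1 mulrA.
Qed.

Lemma uniq_three o k l :
  uniq [:: o; k; l] -> [/\ o != k, o != l & k != l].
Proof. by rewrite /= !inE negb_or => /and3P[/andP[]]. Qed.

Lemma not_frozen (i : 'I_(3 + 0)) : frozen i = false.
Proof. by rewrite /frozen leqNgt ltn_ord. Qed.

(* The class, closed under mutation, of quivers that keeps at least two arrows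
   between [o] and each other vertex: the coprimality conditions prevent the
   cofactors of [b] and [a] from vanishing. *)
Definition ab_quiver (a b : nat) o k l q : Prop :=
  [/\ no_2cycles q,
      exists2 u : int, net q (v o) (v k) = b%:Z * u & coprimez a%:Z u,
      exists2 u : int, net q (v o) (v l) = a%:Z * u & coprimez b%:Z u
    & exists w : int, net q (v k) (v l) = a%:Z * b%:Z * w].

Lemma net_anti q i j : net q j i = - net q i j.
Proof. by rewrite /net opprB. Qed.

Lemma ab_quiver_sym a b o k l q :
  ab_quiver a b o k l q -> ab_quiver b a o l k q.
Proof.
by case=> h hk hl [w hw]; split=> //; exists (- w); rewrite net_anti hw; ring.
Qed.

(** The net count between [k] and [l] changes by a multiple of [(b * u) * (a * u')]; the other two
    change sign. *)
Lemma ab_quiver_mutate_o a b o k l q : uniq [:: o; k; l] ->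
  ab_quiver a b o k l q -> ab_quiver a b o k l (mutate_quiver o q).
Proof.
move/uniq_three=> [ok ol kl].
case=> hq [u hu cu] [u' hu' cu'] [w hw]; split.
- exact: no_2cycles_mutate.
- exists (- u); last by rewrite coprimezN.
  by rewrite net_mutate ?not_frozen // eqxx hu mulrN.
- exists (- u'); last by rewrite coprimezN.
  by rewrite net_mutate ?not_frozen // eqxx hu' mulrN.
- rewrite net_mutate ?not_frozen // !(inj_eq (@lshift_inj _ _)).
  rewrite !(eq_sym _ o) (negbTE ok) (negbTE ol) /=.
  have [s ->] := net_paths (v k) (v l) (v o) hq.
  by exists (w - s * u * u'); rewrite hw (net_anti q (v o)) hu hu'; ring.
Qed.

Lemma coprimez_addM (a u x : int) : coprimez a (u + a * x) = coprimez a u.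
Proof. by rewrite /coprimez addrC mulrC gcdzMDl. Qed.

(** The net count from [o] to [l] changes by a multiple of [(b * u) * (a * b * w)], so its cofactor
    [u'] changes by a multiple of [b] and stays prime to [b]. *)
Lemma ab_quiver_mutate_k a b o k l q : uniq [:: o; k; l] ->
  ab_quiver a b o k l q -> ab_quiver a b o k l (mutate_quiver k q).
Proof.
move/uniq_three=> [ok ol kl].
case=> hq [u hu cu] [u' hu' cu'] [w hw]; split.
- exact: no_2cycles_mutate.
- exists (- u); last by rewrite coprimezN.
  by rewrite net_mutate ?not_frozen // eqxx orbT hu mulrN.
- have [s es] := net_paths (v o) (v l) (v k) hq.
  exists (u' + b%:Z * (s * b%:Z * u * w)); last by rewrite coprimez_addM.
  rewrite net_mutate ?not_frozen // !(inj_eq (@lshift_inj _ _)).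
  by rewrite (eq_sym l) (negbTE ok) (negbTE kl) /= es hu hu' hw; ring.
- exists (- w).
  by rewrite net_mutate ?not_frozen // eqxx hw mulrN.
Qed.

(** Being prime to [a >= 2], the cofactor [u] is nonzero, so there are at least [b] arrows. *)
Lemma ab_quiver_arrows a b o k l q : (1 < a)%N -> (1 < b)%N ->
  ab_quiver a b o k l q -> (1 < q (v o) (v k) + q (v k) (v o))%N.
Proof.
move=> a1 b1 [hq [u hu cu] _ _].
have u0 : u != 0.
  by apply: contraTneq cu => ->; rewrite /coprimez gcdz0; lia.
have [e|e] := hq (v o) (v k); rewrite /net e in hu *; nia.
Qed.

Lemma ab_quiver_quiver_ab a b : ab_quiver a b ord0 1 2 (quiver_ab a b).
Proof.
split.
- move=> i j; rewrite !mxE.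
  by case: i j => [[|[|[|i]]] hi] [[|[|[|j]]] hj] //=; lia.
- exists (-1); last by rewrite coprimezN /coprimez gcdz1.
  by rewrite /net !mxE /=; lia.
- exists (-1); last by rewrite coprimezN /coprimez gcdz1.
  by rewrite /net !mxE /=; lia.
- by exists 0; rewrite /net !mxE /=; lia.
Qed.

End ThreeVertices.

(** * Exchange relations and positivity *)

Section SeedMutation.
Variables (C : closedFieldType) (n m : nat).
Implicit Types S : seed C n m.

Lemma cluster_mutate (k : 'I_n) S i (v := lshift m k) : no_2cycles (quiver S) ->
  cluster (mutate k S) i =
    if i == v then (cluster S v)^-1 *
      (\prod_j cluster S j ^+ quiver S j v
       + \prod_j cluster S j ^+ quiver S v j)
    else cluster S i.
Proof.
move=> h; rewrite /= ffunE; case: eqP => // ->.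
by rewrite prod_in_arrows // prod_out_arrows.
Qed.

Lemma exchange_relation (k : 'I_n) S (v := lshift m k) :
  no_2cycles (quiver S) -> cluster S v != 0 ->
  cluster S v * cluster (mutate k S) v =
    \prod_j cluster S j ^+ quiver S j v + \prod_j cluster S j ^+ quiver S v j.
Proof. by move=> h x0; rewrite cluster_mutate // eqxx mulVKf. Qed.

Lemma mutate_quiver_row (k : 'I_n) (q : 'M[nat]_(n + m)) i (v := lshift m k) :
  no_2cycles q -> mutate_quiver k q v i = q i v.
Proof.
move=> hq; have qv : q v v = 0%N by case: (hq v v).
rewrite !mxE -/v eqxx ?orbT /= frozen_lshift ?andbF /= qv.
by case: (hq i v) => ->; lia.
Qed.

Lemma mutate_quiver_col (k : 'I_n) (q : 'M[nat]_(n + m)) i (v := lshift m k) :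
  no_2cycles q -> mutate_quiver k q i v = q v i.
Proof.
move=> hq; have qv : q v v = 0%N by case: (hq v v).
rewrite !mxE -/v eqxx ?orbT /= frozen_lshift ?andbF /= qv.
by case: (hq i v) => ->; lia.
Qed.

(** The exchange polynomial at [v] does not involve the variable at [v], and reversing the arrows
    only swaps its two monomials. *)
Lemma cluster_mutate2 (k : 'I_n) S (v := lshift m k) : no_2cycles (quiver S) ->
  cluster S v != 0 -> cluster (mutate k S) v != 0 ->
  cluster (mutate k (mutate k S)) v = cluster S v.
Proof.
move=> h x0 x0'; rewrite cluster_mutate ?eqxx; last exact: no_2cycles_mutate.
have qv : quiver S v v = 0%N by case: (h v v).
have e q : q v = 0%N -> \prod_j cluster (mutate k S) j ^+ q j
                      = \prod_j cluster S j ^+ q j.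
  move=> q0; apply: eq_bigr => j _; rewrite cluster_mutate //.
  by case: eqP => // ->; rewrite q0 !expr0.
rewrite (e (fun j => quiver (mutate k S) j v)) ?mutate_quiver_col //.
rewrite (e (quiver (mutate k S) v)) ?mutate_quiver_row //.
have -> : \prod_j cluster S j ^+ quiver (mutate k S) j v
        + \prod_j cluster S j ^+ quiver (mutate k S) v j
      = cluster S v * cluster (mutate k S) v.
  rewrite (exchange_relation h x0) [RHS]addrC.
  congr (_ + _).
    by apply: eq_bigr => j _; rewrite mutate_quiver_col.
  by apply: eq_bigr => j _; rewrite mutate_quiver_row.
move: (cluster (mutate k S) v) x0' => x' x0'.
by rewrite mulrCA mulVf ?mulr1.
Qed.

Lemma Seeds_no_2cycles S S' : no_2cycles (quiver S) -> Seeds S S' ->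
  no_2cycles (quiver S').
Proof. by move=> h; elim=> // *; exact: no_2cycles_mutate. Qed.

(** Exchange relations are subtraction-free, so positive values propagate. This serves to show that
    cluster variables are nonzero. *)
Lemma place_cluster_gt0 (K : numFieldType) (P : ratfun C (n + m) -> K -> Prop)
    S S' : place P -> no_2cycles (quiver S) -> Seeds S S' ->
  (forall i, exists2 c, 0 < c & P (cluster S i) c) ->
  forall i, exists2 c, 0 < c & P (cluster S' i) c.
Proof.
move=> hP h hS hx; elim: hS => // {}S' k hS' IH i.
have pos_prod e : exists2 c, 0 < c & P (\prod_j cluster S' j ^+ e j) c.
  elim/big_ind: _ => [|f g [c c0 hf] [d d0 hg]|j _].
  - by exists 1 => //; exact: place1.
  - by exists (c * d); [exact: mulr_gt0|exact: placeM].
  - have [c c0 hc] := IH j.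
    by exists (c ^+ e j); [exact: exprn_gt0|exact: placeX].
rewrite cluster_mutate; last exact: Seeds_no_2cycles hS'.
case: eqP => // _; have [x x0 hx0] := IH (lshift m k).
have [c c0 hc] := pos_prod (fun j => quiver S' j (lshift m k)).
have [d d0 hd] := pos_prod (quiver S' (lshift m k)).
exists (x^-1 * (c + d)); first by rewrite mulr_gt0 ?invr_gt0 ?addr_gt0.
by apply: placeM (placeD hP hc hd) => //; apply: placeV => //; rewrite gt_eqF.
Qed.

End SeedMutation.

(** * Persistence of the vanishing pattern under mutation *)

Section DeepSeeds.
Variables (C : closedFieldType) (K : fieldType).
Variables (P : ratfun C (3 + 0) -> K -> Prop) (hP : place P).
Notation v := (lshift 0).
Implicit Types (S : seed C 3 0) (o k l : 'I_3).

Definition unit_at (f : ratfun C (3 + 0)) : Prop := exists2 c, c != 0 & P f c.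

(** The variable produced by mutation at [o] is included because that mutation exchanges it with the
    current one. *)
Definition deep_at o k l S : Prop :=
  [/\ P (cluster S (v o)) 0, P (cluster (mutate o S) (v o)) 0,
      unit_at (cluster S (v k)) & unit_at (cluster S (v l))].

Lemma deep_at_sym o k l S : deep_at o k l S -> deep_at o l k S.
Proof. by case. Qed.

Lemma deep_at_mutate_o o k l S : uniq [:: o; k; l] -> no_2cycles (quiver S) ->
  cluster S (v o) != 0 -> cluster (mutate o S) (v o) != 0 ->
  deep_at o k l S -> deep_at o k l (mutate o S).
Proof.
move/uniq_three=> [ok ol _] h x0 x0' [ho ho' hk hl].
split=> //; first by rewrite cluster_mutate2.
  by rewrite cluster_mutate // (inj_eq (@lshift_inj _ _)) eq_sym (negbTE ok).
by rewrite cluster_mutate // (inj_eq (@lshift_inj _ _)) eq_sym (negbTE ol).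
Qed.

Lemma quiver_mutate k S : quiver (mutate k S) = mutate_quiver k (quiver S).
Proof. by []. Qed.

(** This is [place_exchange] with [p] the number of arrows between [o] and [k], applied once for
    each direction of these arrows. *)
Lemma deep_at_mutate_k o k l S : uniq [:: o; k; l] -> no_2cycles (quiver S) ->
  (1 < quiver S (v o) (v k) + quiver S (v k) (v o))%N ->
  (forall i, cluster S i != 0) ->
  cluster (mutate k S) (v o) != 0 ->
  deep_at o k l S -> deep_at o k l (mutate k S).
Proof.
move=> u3; have [ok ol kl] := uniq_three u3 => h q2 x0 x0'.
have neq_v i j : i != j -> (v i == v j :> 'I_(3 + 0)) = false.
  by move=> /negbTE ij; rewrite (inj_eq (@lshift_inj _ _)).
have qii i : quiver S i i = 0%N by case: (h i i).
have h' := no_2cycles_mutate k (quiver S).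
have q'ii i : mutate_quiver k (quiver S) i i = 0%N by case: (h' i i).
case=> ho ho' [ck ck0 hk] [cl cl0 hl].
have exo := exchange_relation h (x0 (v o)).
have exk := exchange_relation h (x0 (v k)).
have exw := @exchange_relation C 3 0 o (mutate k S) h' x0'.
(* The mutation rule for the arrows between [l] and [o] becomes the identity on exponents that
   [place_exchange] requires. *)
have net_lo := @net_mutate 3 0 k (quiver S) (v l) (v o) h.
rewrite !not_frozen !neq_v // in net_lo; last by rewrite eq_sym.
have {}net_lo := net_lo isT; rewrite /net orbb in net_lo.
have eo : cluster (mutate k S) (v o) = cluster S (v o).
  by rewrite cluster_mutate // neq_v.
have el : cluster (mutate k S) (v l) = cluster S (v l).
  by rewrite cluster_mutate // neq_v // eq_sym.
rewrite !(prod_three _ u3) !quiver_mutate !qii !q'ii in exo exk exw.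
rewrite !(mutate_quiver_row, mutate_quiver_col) // eo el in exw.
rewrite !expr0 ?mulr1 !mul1r in exo exk exw.
rewrite /deep_at eo el.
have pos : forall e, (0 < e)%N -> forall f, P f 0 -> P (f ^+ e) 0.
  by move=> e e0 f /(placeX hP e); rewrite expr0n eqn0Ngt e0.
(* One monomial of the exchange relation at [k] contains the vanishing variable; the other is a
   unit. *)
have unit_k s s' : cluster S (v k) * cluster (mutate k S) (v k)
    = cluster S (v l) ^+ s' + s ->
    P s 0 -> unit_at (cluster (mutate k S) (v k)).
  move=> e hs; exists ((cl ^+ s' + 0) / ck).
    by rewrite addr0 mulf_neq0 ?invr_neq0 ?expf_neq0.
  apply: (place_divl hP _ hk ck0); rewrite e.
  exact: (placeD hP (placeX hP _ hl) hs).
have [e|e] := h (v o) (v k);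
  rewrite e ?mul0n ?muln0 ?expr0 ?mul1r ?mulr1 in q2 exo exk exw net_lo.
- have z1p : P (cluster S (v o) ^+ quiver S (v k) (v o)
                * cluster S (v l) ^+ quiver S (v k) (v l)) 0.
    rewrite -(mul0r (cl ^+ quiver S (v k) (v l))).
    apply: (placeM hP _ (placeX hP _ hl)).
    by apply: pos => //; clear -q2; lia.
  split=> //; last by exists cl.
    apply: (place_exchange hP (x0 (v o)) _ ho ho' hk ck0 hl cl0 exo exk exw).
      by clear -q2; lia.
    by clear -net_lo; lia.
  exact: unit_k exk z1p.
- have z1p : P (cluster S (v o) ^+ quiver S (v o) (v k)
                * cluster S (v l) ^+ quiver S (v l) (v k)) 0.
    rewrite -(mul0r (cl ^+ quiver S (v l) (v k))).
    apply: (placeM hP _ (placeX hP _ hl)).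
    by apply: pos => //; clear -q2; lia.
  (* With the arrows reversed, swapping the monomials of each relation restores the shape of the
     first case. *)
  rewrite addrC in exo; rewrite addrC in exk; rewrite addrC in exw.
  split=> //; last by exists cl.
    apply: (place_exchange hP (x0 (v o)) _ ho ho' hk ck0 hl cl0 exo exk exw).
      by clear -q2; lia.
    by clear -net_lo; lia.
  exact: unit_k exk z1p.
Qed.

End DeepSeeds.

Lemma deep_at_Seeds (C : closedFieldType) (K : fieldType)
    (P : ratfun C (3 + 0) -> K -> Prop) a b (S S' : seed C 3 0)
    (o k l : 'I_3) : place P -> (1 < a)%N -> (1 < b)%N -> uniq [:: o; k; l] ->
  ab_quiver a b o k l (quiver S) ->
  (forall S' i, Seeds S S' -> cluster S' i != 0) ->
  deep_at P o k l S -> Seeds S S' -> deep_at P o k l S'.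
Proof.
move=> hP a1 b1 u3 qS nz dS hS.
have u3' : uniq [:: o; l; k].
  by have [ok ol kl] := uniq_three u3; rewrite /= !inE negb_or ok ol eq_sym kl.
suff [] : ab_quiver a b o k l (quiver S') /\ deep_at P o k l S' by [].
elim: hS => [|{}S' j hS' [qS' dS']]; first by split.
have [h _ _ _] := qS'.
have nz' i := nz _ i hS'; have nzm j' i := nz _ i (Seeds_mutate j' hS').
have : j \in [:: o; k; l].
  have [||_ ->] := uniq_min_size (s2 := enum 'I_3) u3; rewrite ?mem_enum //.
  - by move=> i _; rewrite mem_enum.
  - by rewrite size_enum_ord.
rewrite !inE => /or3P[] /eqP ->.
- split; first exact: ab_quiver_mutate_o.
  exact: deep_at_mutate_o.
- split; first exact: ab_quiver_mutate_k.
  by apply: deep_at_mutate_k => //; exact: ab_quiver_arrows qS'.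
- split.
    by apply/ab_quiver_sym/ab_quiver_mutate_k => //; exact: ab_quiver_sym.
  apply/deep_at_sym/deep_at_mutate_k => //.
    exact: ab_quiver_arrows (ab_quiver_sym qS').
  exact: deep_at_sym.
Qed.

(** * Points of the cluster variety and endomorphisms of the algebra *)

Section Points.
Variables (C : closedFieldType) (n m : nat) (S : seed C n m).

(** The elements with a value form a ring that contains all generators, hence the cluster algebra;
    uniqueness of values makes the chosen function a morphism. *)
Lemma point_of_place (P : ratfun C (n + m) -> C -> Prop) :
  place P -> (forall c, P c%:A c) ->
  (forall S' k, Seeds S S' -> exists c, P (cluster S' (lshift m k)) c) ->
  (forall j, exists2 c, c != 0 & P (cluster S (rshift n j)) c) ->
  exists p : cluster_variety S, forall f, P (val f) (p f).
Proof.
move=> hP hC hx hf.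
have hA f : in_cluster_algebra S f -> exists c, P f c.
  elim=> {f} [S' k hS|j|j|c|f g _ [c hc] _ [d hd]|f g _ [c hc] _ [d hd]].
  - exact: hx.
  - by have [c _ hc] := hf j; exists c.
  - by have [c c0 hc] := hf j; exists c^-1; exact: (placeV hP).
  - by exists c.
  - by exists (c + d); exact: (placeD hP).
  - by exists (c * d); exact: (placeM hP).
have /choice[p hp] (f : cluster_algebra S) : exists c, P (val f) c.
  by apply: hA; case: f => f /= /asboolP.
have pB : zmod_morphism p.
  move=> f g; apply: (place_inj hP (hp _)); rewrite rmorphB.
  exact: (placeB hP (hp f) (hp g)).
have pM : monoid_morphism p.
  split=> [|f g]; apply: (place_inj hP (hp _)).
    by rewrite rmorph1; exact: (place1 hP).
  by rewrite rmorphM; exact: (placeM hP (hp f) (hp g)).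
have pZ : scalable_for *%R p.
  move=> c f; apply: (place_inj hP (hp _)).
  by rewrite linearZ /= -[_ *: _]mulr_algl; exact: (placeM hP (hC c) (hp f)).
pose addp := GRing.isZmodMorphism.Build _ _ p pB.
pose mulp := GRing.isMonoidMorphism.Build _ _ p pM.
pose scalp := GRing.isScalable.Build _ _ _ _ p pZ.
by exists (HB.pack p addp mulp scalp : cluster_variety S).
Qed.

Lemma rmorph_mmap (N : nat) (A B : comNzRingType) (g : {rmorphism A -> B})
    (f : C -> A) (h : 'I_N -> A) (p : {mpoly C[N]}) :
  g (mmap f h p) = mmap (g \o f) (g \o h) p.
Proof.
rewrite /mmap rmorph_sum; apply: eq_bigr => i _; rewrite rmorphM rmorph_prod.
by congr (_ * _); apply: eq_bigr => j _; rewrite rmorphXn.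
Qed.

Lemma eq_mmap (N : nat) (A : comNzRingType) (f f' : C -> A) (h h' : 'I_N -> A)
    (p : {mpoly C[N]}) : f =1 f' -> h =1 h' -> mmap f h p = mmap f' h' p.
Proof.
move=> ef eh; apply: eq_bigr => i _; rewrite ef; congr (_ * _).
exact: mmap1_eq.
Qed.

Let x := cluster_elt (Seeds_refl S).

(** Each element is a quotient of polynomials in the initial cluster, both fixed by [phi], and the
    algebra lies in a field. *)
Lemma endomorphism_eq_id
    (phi : {lrmorphism cluster_algebra S -> cluster_algebra S}) :
  free_generators (cluster S) -> (forall i, phi (x i) = x i) -> phi =1 id.
Proof.
case=> inj gen hx f.
have [P [Q [Q0 ef]]] := gen (val f).
pose ev p : cluster_algebra S := mmap (in_alg (cluster_algebra S)) x p.
have evE p : eval_at (cluster S) p = val (ev p).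
  by rewrite /ev rmorph_mmap; exact: eq_mmap.
have fixE p : phi (ev p) = ev p.
  rewrite /ev rmorph_mmap; apply: eq_mmap => [c|i]; last exact: hx.
  exact: rmorph_alg.
have evQ0 : eval_at (cluster S) Q != 0 by apply: contraNneq Q0 => /inj ->.
have fQ : f * ev Q = ev P.
  apply: val_inj; rewrite -evE; transitivity (val f * eval_at (cluster S) Q).
    by rewrite evE -rmorphM.
  by rewrite ef divfK.
have e : phi f * ev Q = f * ev Q.
  rewrite -{1}(fixE Q) -rmorphM fQ; exact: fixE.
apply: val_inj; apply: (mulIf evQ0); rewrite evE.
by have := congr1 val e; rewrite !rmorphM.
Qed.

End Points.

Lemma no_2cycles_ice n m (q : 'M[nat]_(n + m)) :
  is_ice_quiver q -> no_2cycles q.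
Proof. by case. Qed.

(** * Free generators and their specializations *)

Section FreeGenerators.
Variables (C : closedFieldType) (N : nat) (z : {ffun 'I_N -> ratfun C N}).
Hypothesis hz : free_generators z.

Lemma eval_atX i : eval_at z 'X_i = z i.
Proof. by rewrite /eval_at mmapX mmap1U. Qed.

Lemma free_generators_binomial i e (c d : C) : (0 < e)%N ->
  c%:A + d *: z i ^+ e = 0 -> c = 0 /\ d = 0.
Proof.
move=> e0 h; have p0 : c%:MP + d *: 'X_i ^+ e = 0 :> {mpoly C[N]}.
  apply: (hz.1); rewrite /eval_at mmapD mmapC mmapZ rmorphXn /=.
  by rewrite -/(eval_at _ _) eval_atX mulr_algl.
(* Evaluation at 0 isolates [c]; evaluation at 1 then gives [d]. *)
have /(congr1 (meval (fun=> 0))) := p0.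
rewrite mevalD mevalC mevalZ rmorphXn /= mevalXU expr0n eqn0Ngt e0.
rewrite mulr0 addr0 meval0 => c0.
have /(congr1 (meval (fun=> 1))) := p0.
rewrite mevalD mevalC mevalZ rmorphXn /= mevalXU expr1n.
by rewrite mulr1 meval0 c0 add0r.
Qed.

(** Free generators span a polynomial ring, so their values can be prescribed at will. *)
Lemma place_free_generators (K : fieldType) (f : {rmorphism C -> K})
    (c : 'I_N -> K) :
  exists P : ratfun C N -> K -> Prop,
    [/\ place P, forall d, P d%:A (f d), forall i, P (z i) (c i)
      & forall p q, mmap f c q != 0 ->
          P (eval_at z p / eval_at z q) (mmap f c p / mmap f c q)].
Proof.
pose iota : {rmorphism {mpoly C[N]} -> ratfun C N} :=
  mmap (in_alg (ratfun C N)) z.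
pose phi : {rmorphism {mpoly C[N]} -> K} := mmap f c.
have iota_inj p : iota p = 0 -> p = 0 by exact: (hz.1).
have hP := @place_specializes _ _ _ iota phi iota_inj.
exists (specializes iota phi); split=> // [d|i|p q q0].
- by have := @specializes_intro _ _ _ iota phi d%:MP; rewrite /= !mmapC.
- by have := @specializes_intro _ _ _ iota phi 'X_i; rewrite /= !mmapX !mmap1U.
- apply: (placeM hP); first exact: specializes_intro.
  by apply: (placeV hP) => //; exact: specializes_intro.
Qed.

End FreeGenerators.

(** * Construction of the mysterious point *)

Section MainPlace.
Variables (C : numClosedFieldType) (a b : nat) (S : seed C 3 0).
Hypotheses (a0 : (0 < a)%N) (hS : is_seed S) (qS : quiver S = quiver_ab a b).
Notation v := (lshift 0).
Notation x i := (cluster S (v i)).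

Lemma seed_no_2cycles : no_2cycles (quiver S).
Proof. by case: hS => /no_2cycles_ice. Qed.

Lemma uniq_vertices : uniq [:: ord0; 1; 2 : 'I_3]. Proof. by []. Qed.

Lemma place_gt0 : exists P : ratfun C (3 + 0) -> C -> Prop,
  place P /\ forall i, exists2 c, 0 < c & P (cluster S i) c.
Proof.
have [P [hP _ hx _]] := place_free_generators hS.2 idfun (fun=> 1 : C).
by exists P; split=> // i; exists 1.
Qed.

(** The place that sends the initial cluster to 1 gives every cluster variable a positive value. *)
Lemma cluster_neq0 S' i : Seeds S S' -> cluster S' i != 0.
Proof.
move=> hS'; have [P [hP hx]] := place_gt0.
have [c c0 hc] := place_cluster_gt0 hP seed_no_2cycles hS' hx i.
by apply: (place_neq0 hP hc); rewrite gt_eqF.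
Qed.

Lemma exchange0 : x 0 * cluster (mutate 0 S) (v 0) = x 1 ^+ b * x 2 ^+ a + 1.
Proof.
rewrite (exchange_relation seed_no_2cycles); last exact/cluster_neq0/Seeds_refl.
by rewrite !(prod_three _ uniq_vertices) qS !mxE /= !expr0 !mul1r.
Qed.

Lemma exchange1 : x 1 * cluster (mutate 1 S) (v 1) = 1 + x 0 ^+ b.
Proof.
rewrite (exchange_relation seed_no_2cycles); last exact/cluster_neq0/Seeds_refl.
by rewrite !(prod_three _ uniq_vertices) qS !mxE /= !expr0 !mulr1.
Qed.

Lemma exchange2 : x 2 * cluster (mutate 2 S) (v 2) = 1 + x 0 ^+ a.
Proof.
rewrite (exchange_relation seed_no_2cycles); last exact/cluster_neq0/Seeds_refl.
by rewrite !(prod_three _ uniq_vertices) qS !mxE /= !expr0 !mulr1.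
Qed.

(* The seed is specialized first to the line [x1 = T, x2 = 1, x3 = r] with
   [r ^ a = -1], on which [x2 ^ b * x3 ^ a + 1] vanishes, then to [T = 0]. *)
Lemma deep_place : exists P : ratfun C (3 + 0) -> C -> Prop,
  [/\ place P, forall c, P c%:A c & deep_at P 0 1 2 S].
Proof.
pose r : C := a.-root (-1).
have ra : r ^+ a = -1 by rewrite /r rootCK.
pose line (i : 'I_(3 + 0)) : {poly C} :=
  if i == v 0 then 'X else if i == v 1 then 1 else r%:P.
pose frac : {rmorphism {poly C} -> {fraction {poly C}}} := @tofrac {poly C}.
have [P [hP hC hx hfrac]] := place_free_generators hS.2
  (frac \o @polyC C : {rmorphism C -> {fraction {poly C}}}) (frac \o line).
pose ev0 : {rmorphism {poly C} -> C} := horner_eval 0.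
have tofrac0 (p : {poly C}) : frac p = 0 -> p = 0.
  by move/eqP; rewrite /frac /= tofrac_eq0 => /eqP.
have hQ := @place_specializes _ _ _ frac ev0 tofrac0.
have hQi := @specializes_intro _ _ _ frac ev0.
exists (fun f c => exists2 g, P f g & specializes frac ev0 g c).
have hPQ := place_comp hP hQ.
split=> // [c|].
  exists (frac c%:P) => //.
  by have := hQi c%:P; rewrite /= /horner_eval hornerC.
split.
- exists (frac 'X); first exact: hx.
  by have := hQi 'X; rewrite /= /horner_eval hornerX.
- exists 0; last exact: (place0 hQ).
  (* At [T = 0] the quotient defining x1' reads 0/0. On the line its denominator ['X] is nonzero and
     its numerator is [r ^+ a + 1 = 0], so its value there is 0. *)
  have := hfrac ('X_(v 1) ^+ b * 'X_(v 2) ^+ a + 1) 'X_(v 0).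
  rewrite /eval_at !mmapX !mmap1U.
  rewrite !mmapD !rmorphM !rmorphXn !rmorph1 /= !mmapX !mmap1U /=.
  rewrite -exchange0 mulrAC mulfV ?cluster_neq0 //; last exact: Seeds_refl.
  rewrite mul1r rmorph1 expr1n mul1r -!rmorphXn ra.
  rewrite rmorphN rmorphN !rmorph1 addNr mul0r.
  by apply; rewrite /frac /= tofrac_eq0 polyX_eq0.
- exists 1; first exact: oner_neq0.
  by exists 1; [have := hx (v 1); rewrite /= rmorph1|exact: (place1 hQ)].
- exists r.
    apply: contraTneq (oner_neq0 C) => r0; move: ra.
    by rewrite r0 expr0n eqn0Ngt a0 => /eqP; rewrite eq_sym oppr_eq0 => ->.
  exists (frac r%:P); first exact: (hx (v 2)).
  by have := hQi r%:P; rewrite /= /horner_eval hornerC.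
Qed.

(** If the mutated variable is scaled by [c], applying [phi] to the relation gives
    [c * (1 + x1 ^ e) = 1 + t ^ e * x1 ^ e]; freeness of [x1] yields [c = 1] and [c = t ^ e]. *)
Lemma dilation_root (phi : {lrmorphism cluster_algebra S -> cluster_algebra S})
    (k : 'I_3) e (t : C) (y := fun i => cluster_elt (Seeds_refl S) (v i)) :
  (0 < e)%N -> x k * cluster (mutate k S) (v k) = 1 + x 0 ^+ e ->
  dilation phi -> phi (y k) = y k -> phi (y 0) = t *: y 0 -> t ^+ e = 1.
Proof.
move=> e0 xe [_ dil] yk y0.
have [c _ hc] := dil _ (Seeds_mutate k (Seeds_refl S)) (v k).
set y' := cluster_elt _ _ in hc.
have ye : y k * y' = 1 + y 0 ^+ e.
  by apply: val_inj; rewrite rmorphM rmorphD rmorphXn rmorph1; exact: xe.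
have := congr1 phi ye.
rewrite rmorphM rmorphD rmorphXn rmorph1 /= yk hc y0 -scalerAr ye exprZn => h.
have {}h : (c - 1)%:A + (c - t ^+ e) *: y 0 ^+ e = 0.
  have -> : (c - 1)%:A + (c - t ^+ e) *: y 0 ^+ e
          = c *: (1 + y 0 ^+ e) - (1 + t ^+ e *: y 0 ^+ e).
    by rewrite !scalerBl scale1r scalerDr opprD addrACA.
  by rewrite h subrr.
have {}h : (c - 1)%:A + (c - t ^+ e) *: x 0 ^+ e = 0 :> ratfun C (3 + 0).
  have := congr1 val h; rewrite rmorphD rmorph0 => h'.
  by rewrite -[RHS]h' -[x 0]/(val (y 0)) -rmorphXn.
have [/subr0_eq c1 /subr0_eq ct] := free_generators_binomial hS.2 e0 h.
by rewrite -ct c1.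
Qed.

Lemma coprime_root_eq1 (t : C) :
  coprime a b -> t ^+ a = 1 -> t ^+ b = 1 -> t = 1.
Proof.
(* Bezout provides [u] and [w] with [1 + u * b = w * a]. *)
move=> /eqP cab ta tb; have [u _] := Bezoutl b a0.
rewrite cab => /dvdnP[w e].
rewrite -[t]mulr1 -[1 in LHS](expr1n _ u) -tb -exprM -exprS (mulnC b).
by rewrite -add1n e mulnC exprM ta expr1n.
Qed.

Lemma exists_mysterious : (1 < a)%N -> (1 < b)%N -> coprime a b ->
  exists p : cluster_variety S, mysterious p.
Proof.
move=> a1 b1 cab; have [P [hP hC dS]] := deep_place.
have dSeeds S' : Seeds S S' -> deep_at P 0 1 2 S'.
  apply: (deep_at_Seeds hP a1 b1 uniq_vertices) => //.
    by rewrite qS; exact: ab_quiver_quiver_ab.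
  by move=> *; exact: cluster_neq0.
have [||p hp] := @point_of_place C 3 0 S P hP hC; last 1 first.
- have pE S' (hS' : Seeds S S') i c :
      P (cluster S' i) c -> p (cluster_elt hS' i) = c.
    by move=> h; exact: (place_inj hP (hp (cluster_elt hS' i)) h).
  exists p; split.
    move=> S' hS' /(_ (v 0)); have [h0 _ _ _] := dSeeds S' hS'.
    by rewrite (pE _ _ _ _ h0) eqxx.
  move=> phi dphi pphi; have [_ _ [c1 c10 h1] [c2 c20 h2]] := dS.
  (* If [d] is the scaling factor, invariance of the point gives [d * c = c] with [c] nonzero, so
     [d = 1]. *)
  have fix_unit i c : P (x i) c -> c != 0 ->
      phi (cluster_elt (Seeds_refl S) (v i)) = cluster_elt (Seeds_refl S) (v i).
    move=> hi c0; have [d _ hd] := dphi.2 S (Seeds_refl S) (v i).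
    have := pphi (cluster_elt (Seeds_refl S) (v i)).
    rewrite /= hd linearZ /= (pE _ _ _ _ hi) => /(canRL (mulfK c0)).
    by rewrite divff // => ->; rewrite scale1r.
  have f1 := fix_unit 1 _ h1 c10; have f2 := fix_unit 2 _ h2 c20.
  have [t _ ht] := dphi.2 S (Seeds_refl S) (v 0).
  have t1 : t = 1.
    apply: coprime_root_eq1 => //.
      exact: dilation_root (ltnW a1) exchange2 dphi f2 ht.
    exact: dilation_root (ltnW b1) exchange1 dphi f1 ht.
  apply: endomorphism_eq_id hS.2 _ => i.
  case: (split_ordP i) => [j ->|[]//].
  have : j \in [:: 0; 1; 2 : 'I_3] by case: j => [[|[|[|]]]].
  by rewrite !inE => /or3P[] /eqP -> //; rewrite ht t1 scale1r.
(* Every cluster variable has a value: 0 at the first vertex, a unit at the others. *)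
- move=> S' k hS'; have [h0 _ [c1 _ h1] [c2 _ h2]] := dSeeds S' hS'.
  have : k \in [:: 0; 1; 2 : 'I_3] by case: k => [[|[|[|]]]].
  by rewrite !inE => /or3P[] /eqP ->; [exists 0|exists c1|exists c2].
- by case.
Qed.

End MainPlace.

Theorem theorem1p3 (R : realType) (a b : nat) (S : seed R[i] 3 0) :
  (0 < a)%N -> (0 < b)%N -> gcdn a b = 1%N -> (2 <= minn a b)%N ->
  is_seed S -> quiver S = quiver_ab a b ->
  exists p : cluster_variety S, mysterious p.
Proof.
move=> a0 b0 cab; rewrite leq_min => /andP[a1 b1] hS qS.
by apply: (@exists_mysterious _ a b S a0 hS qS a1 b1); apply/eqP.
Qed.
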